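(* Let $G$ be a group and let $L,N$ be normal subgroups of $G$ with $L\geqslant N$, and $i\colon N\hookrightarrow L$ the inclusion. Assume $\mathcal{W}(G,L,N)$ is finite dimensional with $\ell=\dim_{\mathbb{R}}\mathcal{W}(G,L,N)$. Take any basis of $\mathcal{W}(G,L,N)$ and any representatives $\nu_1,\dots,\nu_\ell\in\mathrm{Q}(N)^G$ of it. Then there exist $\mathscr{C}_1,\mathscr{C}_2>0$ (depending on $\nu_1,\dots,\nu_\ell$) such that for every $\nu\in\mathrm{Q}(N)^G$ there exist $k\in\mathrm{H}^1(N)^G$ and $\psi\in\mathrm{Q}(L)^G$ with $\nu=k+i^*\psi+\sum_{j=1}^\ell a_j\nu_j$ and $$\mathscr{D}(\nu)\ge\mathscr{C}_1^{-1}\Big(\mathscr{D}(\psi)+\mathscr{C}_2^{-1}\sum_{j=1}^\ell|a_j|\Big),$$ where $(a_1,\dots,a_\ell)\in\mathbb{R}^\ell$ is the unique tuple with $[\nu]=\sum_j a_j[\nu_j]$ in $\mathcal{W}(G,L,N)$.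
   Context: For a group $H$, $\psi\colon H\to\mathbb{R}$ is homogeneous if $\psi(h^n)=n\psi(h)$; its defect is $\mathscr{D}(\psi)=\sup_{h_1,h_2\in H}|\psi(h_1h_2)-\psi(h_1)-\psi(h_2)|$; quasimorphism means finite defect. $\mathrm{Q}(N)^G$ (resp. $\mathrm{Q}(L)^G$): homogeneous quasimorphisms on $N$ (resp. $L$) invariant under conjugation by $G$; $\mathrm{H}^1(N)^G$: $G$-invariant homomorphisms $N\to\mathbb{R}$; $i^*\psi=\psi|_N$; $\mathcal{W}(G,L,N)=\mathrm{Q}(N)^G/(\mathrm{H}^1(N)^G+i^*\mathrm{Q}(L)^G)$ and $[\nu]$ denotes the class of $\nu$. If $\ell=0$ the sums are empty. *)

(* Defs.v *)
From HB Require Import structures.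
From mathcomp Require Import all_boot all_order all_algebra.
From mathcomp Require Import classical_sets reals.

Set Implicit Arguments.
Unset Strict Implicit.
Unset Printing Implicit Defensive.

Import Order.TTheory GRing.Theory Num.Theory.
Local Open Scope classical_set_scope.
Local Open Scope ring_scope.

Section Defs.
Variables (G : groupType) (R : realType).

Definition is_subgroup (H : G -> Prop) : Prop :=
  [/\ H 1%g, (forall x y, H x -> H y -> H (x * y)%g) &
      (forall x, H x -> H (x^-1)%g)].

Definition is_normal (H : G -> Prop) : Prop :=
  is_subgroup H /\ forall x g, H x -> H (x ^ g)%g.

(* Functions H -> R are represented by functions G -> R; only their values
   on H matter. *)

Definition homogeneous (H : G -> Prop) (psi : G -> R) : Prop :=
  forall h, H h -> forall n : nat,
    psi (h ^+ n)%g = n%:R * psi h /\ psi (h ^- n)%g = - (n%:R * psi h).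

Definition defect_set (H : G -> Prop) (psi : G -> R) : set R :=
  [set r | exists x y, [/\ H x, H y & r = `|psi (x * y)%g - psi x - psi y|]].

(* The defect sup_{h1,h2 in H} |psi(h1 h2) - psi h1 - psi h2| (finite for
   quasimorphisms, the only case where it is used). *)
Definition defect (H : G -> Prop) (psi : G -> R) : R := sup (defect_set H psi).

Definition quasimorphism (H : G -> Prop) (psi : G -> R) : Prop :=
  exists C : R, forall x y, H x -> H y -> `|psi (x * y)%g - psi x - psi y| <= C.

Definition G_invariant (H : G -> Prop) (psi : G -> R) : Prop :=
  forall g h, H h -> psi (h ^ g)%g = psi h.

Definition QG (H : G -> Prop) (psi : G -> R) : Prop :=
  [/\ homogeneous H psi, quasimorphism H psi & G_invariant H psi].

Definition H1G (H : G -> Prop) (k : G -> R) : Prop :=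
  (forall x y, H x -> H y -> k (x * y)%g = k x + k y) /\ G_invariant H k.

(* [nu] = sum_j a_j [nu_j] in W(G,L,N):
   nu - sum_j a_j nu_j lies in H^1(N)^G + i^* Q(L)^G. *)
Definition W_combination (L N : G -> Prop) (l : nat) (nus : 'I_l -> G -> R)
    (nu : G -> R) (a : 'I_l -> R) : Prop :=
  exists k psi, [/\ H1G N k, QG L psi &
    forall x, N x -> nu x = k x + psi x + \sum_(j < l) a j * nus j x].

Definition W_basis (L N : G -> Prop) (l : nat) (nus : 'I_l -> G -> R) : Prop :=
  [/\ forall j, QG N (nus j),
      (forall nu, QG N nu -> exists a, W_combination L N nus nu a) &
      (forall a, W_combination L N nus (fun _ => 0) a -> forall j, a j = 0)].

End Defs.

(* Main.v *)
Require Import Defs.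
From HB Require Import structures.
From mathcomp Require Import all_boot all_order all_algebra.
From mathcomp Require Import boolp classical_sets functions reals.
From mathcomp Require Import ring lra.
Set Implicit Arguments.
Unset Strict Implicit.
Unset Printing Implicit Defensive.
Import Order.TTheory GRing.Theory Num.Theory.
Local Open Scope classical_set_scope.
Local Open Scope ring_scope.

(** The space Q(N)^G / H^1(N)^G is complete for the defect norm, and so is
Q(L)^G / H^1(L)^G (+) R^l for the norm defect + l^1. The map
(psi, a) |-> i^* psi + sum_j a_j nu_j between them is bounded, and it is onto
because the nu_j span W(G, L, N); hence it is open, which is the claimed
inequality. Quotients are avoided by working with seminorms, whose kernel is the
space of invariant homomorphisms. *)

(** * Real sequences with a geometric rate of convergence *)

Section GeometricConvergence.
Variable R : realType.
Implicit Types (u : nat -> R) (c r x K : R).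

(** For positive [x], the Archimedean property gives an [n] with [2 ^+ n] above [K / x], which
    contradicts the bound. This is how an estimate up to a multiple of [2^-1 ^+ n] becomes an exact
    inequality. *)
Lemma le0_geometric x K : (forall n, x <= K * 2^-1 ^+ n) -> x <= 0.
Proof.
move=> xK; rewrite leNgt; apply/negP => x0.
have := xK (Num.bound (K / x)).
rewrite leNgt => /negP; apply.
have := upper_nthrootP (leqnn (Num.bound (K / x))).
by rewrite ltr_pdivrMr // exprVn ltr_pdivrMr ?exprn_gt0 // mulrC.
Qed.

(** The intervals of radius [2 * c * 2^-1 ^+ n] around [u n] are nested, because the radius shrinks
    by [c * 2^-1 ^+ n] at each step; the supremum of their left ends lies in all of them. *)
Lemma geometric_cauchy_cvg u c :
  (forall n, `|u n.+1 - u n| <= c * 2^-1 ^+ n) ->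
  exists r, forall n, `|r - u n| <= 2 * c * 2^-1 ^+ n.
Proof.
move=> uc.
pose v n := u n - 2 * c * 2^-1 ^+ n; pose w n := u n + 2 * c * 2^-1 ^+ n.
have vS n : v n <= v n.+1.
  by have := uc n; rewrite /v exprS ler_norml; lra.
have wS n : w n.+1 <= w n.
  by have := uc n; rewrite /w exprS ler_norml; lra.
have vm : {homo v : m n / (m <= n)%N >-> m <= n}.
  by apply: homo_leq => // ? ? ?; apply: le_trans.
have wm : {homo w : m n / (m <= n)%N >-> n <= m}.
  by apply: (@homo_leq _ w (fun x y => y <= x)) => // y x z xy yz; apply: le_trans yz xy.
have c0 : 0 <= c by have := le_trans (normr_ge0 _) (uc 0); rewrite expr0 mulr1.
have vw m n : v m <= w n.
  apply: le_trans (vm _ _ (leq_maxl m n)) _.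
  apply: le_trans (wm _ _ (leq_maxr m n)).
  rewrite /v /w -subr_ge0.
  have : 0 <= c * 2^-1 ^+ maxn m n by rewrite mulr_ge0 // exprn_ge0 // invr_ge0.
  lra.
exists (sup [set v n | n in [set: nat]]) => n.
rewrite distrC ler_distlC; apply/andP; split.
  apply: ub_le_sup; last by exists n.
  by exists (w 0%N) => _ [m _ <-].
by apply: ge_sup; [exists (v 0%N), 0%N | move=> _ [m _ <-]; exact: vw].
Qed.

End GeometricConvergence.

(** * Extension of partial linear functionals *)

Section LinearExtension.
Variables (F : fieldType) (V : lmodType F).
Implicit Types (A B : set (V * F)).

(** A partial linear functional is encoded as a subspace of [V * F], so that Zorn's lemma can work
    with inclusion. By linearity, single-valuedness only has to be asked at 0. *)
Definition functional_graph A :=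
  [/\ A (0, 0), (forall r, A (0, r) -> r = 0) &
      (forall a x r y s, A (x, r) -> A (y, s) -> A (a *: x + y, a * r + s))].

(** The extended functional takes the value 0 at [z]. It stays single-valued because a relation
    [x + a *: z = 0] with [a] nonzero and [x] in the domain of [A] would put [z] in that domain. *)
Lemma functional_graph_extend A (z : V) : functional_graph A ->
  (forall r, ~ A (z, r)) ->
  functional_graph [set p | exists a x, p.1 = x + a *: z /\ A (x, p.2)].
Proof.
move=> [A0 Afun Alin] Az; split.
- by exists 0, 0; rewrite scale0r addr0.
- move=> r [a [x /= [xz Axr]]]; have [a0|a0] := eqVneq a 0.
    by move: xz; rewrite a0 scale0r addr0 => x0; apply: Afun; rewrite x0.
  exfalso; apply: (Az (- a^-1 * r + 0)).
  suff -> : z = - a^-1 *: x + 0 by exact: Alin.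
  have -> : x = - (a *: z) by apply/eqP; rewrite -addr_eq0 -xz.
  by rewrite addr0 scalerN scaleNr opprK scalerA mulVf // scale1r.
- move=> a x r y s [b [x' /= [-> Ax]]] [c [y' [-> Ay]]].
  exists (a * b + c), (a *: x' + y'); split; last exact: Alin.
  by rewrite scalerDr scalerA scalerDl addrACA.
Qed.

Lemma linear_extension A : functional_graph A ->
  exists f : V -> F, (forall a x y, f (a *: x + y) = a * f x + f y) /\
    (forall x r, A (x, r) -> f x = r).
Proof.
(* Zorn is applied to B with B `|` A a functional graph, so that the empty chain
   is covered. *)
move=> hA; pose P B := functional_graph (B `|` A).
have P0 : P set0 by rewrite /P set0U.
have [F' FP tF|M [PM Mmax]] := @Zorn_bigcup (V * F)%type P.
  (* Linearity involves two points of the union, which must be found in one common graph. Two points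
     of [A] use [set0], which may lie outside the chain; hence inclusion in the union in place of
     membership in [F']. *)
  have join p q : (\bigcup_(X in F') X `|` A) p -> (\bigcup_(X in F') X `|` A) q ->
      exists C, [/\ P C, C `<=` \bigcup_(X in F') X, (C `|` A) p & (C `|` A) q].
    have sub C : F' C -> C `<=` \bigcup_(X in F') X.
      by move=> FC x Cx; exists C.
    move=> [[B FB Bp]|Ap] [[C FC Cq]|Aq].
    - have [BC|CB] := tF _ _ FB FC.
        by exists C; split; [exact: FP|exact: sub|left; exact: BC|left].
      by exists B; split; [exact: FP|exact: sub|left|left; exact: CB].
    - by exists B; split; [exact: FP|exact: sub|left|right].
    - by exists C; split; [exact: FP|exact: sub|right|left].
    - by exists set0; split => //; right.
  split.
  - by right; case: hA.
  - move=> r Hr; have [C [[_ + _] _ Cr _]] := join _ _ Hr Hr.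
    exact.
  - move=> a x r y s Hx Hy; have [C [[_ _ CL] sC Cx Cy]] := join _ _ Hx Hy.
    by case: (CL a _ _ _ _ Cx Cy) => [/sC|]; [left|right].
(* A point outside the domain of the maximal graph would allow an extension by one dimension,
   against maximality. *)
have Mtot x : exists r, (M `|` A) (x, r).
  apply: contrapT => /forallNP Hx.
  have PB := functional_graph_extend PM Hx; set B := (X in functional_graph X) in PB.
  have sMB : M `|` A `<=` B.
    by move=> [y s] Hy; exists 0, y; rewrite scale0r addr0.
  apply: (Mmax B); last first.
    rewrite /P; suff -> : B `|` A = B by [].
    by apply/setUidPl => p Ap; apply: sMB; right.
  split; first by move=> p Mp; apply: sMB; left.
  move=> BM; apply: (Hx 0); left; apply: BM; exists 1, 0.
  by rewrite scale1r add0r; case: PM.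
have [f fP] := choice Mtot.
have [_ M0 ML] := PM.
have fE x r : (M `|` A) (x, r) -> f x = r.
  move=> xr; apply/eqP; rewrite -subr_eq0; apply/eqP/M0.
  by have := ML (-1) _ _ _ _ xr (fP x); rewrite scaleN1r addNr mulN1r addrC.
exists f; split; last by move=> x r Ar; apply: fE; right.
by move=> a x y; apply: fE; apply: ML.
Qed.

End LinearExtension.

(** The pairs of a sequence and its geometric limit form a functional graph, single-valued by
    [le0_geometric]; [Lim] is a linear extension of it to all sequences. *)
Lemma generalized_limit (R : realType) :
  exists Lim : (nat -> R) -> R,
    (forall a u v, Lim (fun n => a * u n + v n) = a * Lim u + Lim v) /\
    (forall u r K, (forall n, `|r - u n| <= K * 2^-1 ^+ n) -> Lim u = r).
Proof.
pose A : set ((nat -> R^o) * R) :=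
  [set p | exists K, forall n, `|p.2 - p.1 n| <= K * 2^-1 ^+ n].
have [|f [flin fA]] := @linear_extension R (nat -> R^o) A; last first.
  by exists f; split=> [|u r K uK]; [exact: flin | apply: fA; exists K].
split.
- by exists 0 => n; rewrite /= subrr normr0 mul0r.
- move=> r [K HK]; apply/eqP; rewrite -normr_le0; apply: (@le0_geometric _ _ K) => n.
  by have := HK n; rewrite /= subr0.
- move=> a x r y s [K HK] [K' HK']; exists (`|a| * K + K') => n /=.
  have -> : a * r + s - (a *: x + y) n = a * (r - x n) + (s - y n).
    by rewrite /= addrfctE scalrfctE mulrBr opprD addrACA.
  apply: le_trans (ler_normD _ _) _; rewrite normrM mulrDl -mulrA.
  by apply: lerD => //; apply: ler_wpM2l.
Qed.

(** * Complete seminorms on subspaces *)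

Section CompleteSeminorm.
Variables (R : realType) (V : lmodType R).

(** Completeness is tested on sequences with a geometric rate, and limits are determined only up to
    the kernel of [q]. Nothing is asked of [q] outside [Y], so [defect] qualifies although it has no
    meaning off the quasimorphisms. *)
Record complete_seminorm (Y : V -> Prop) (q : V -> R) : Prop := {
  cs_zero : Y 0;
  cs_lin : forall a x y, Y x -> Y y -> Y (a *: x + y);
  cs_add : forall x y, Y x -> Y y -> q (x + y) <= q x + q y;
  cs_scale : forall a x, Y x -> q (a *: x) = `|a| * q x;
  cs_complete : forall u c, (forall n, Y (u n)) ->
    (forall n, q (u n.+1 - u n) <= c * 2^-1 ^+ n) ->
    exists y K, Y y /\ forall n, q (y - u n) <= K * 2^-1 ^+ n }.

Variables (Y : V -> Prop) (q : V -> R) (hY : complete_seminorm Y q).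

Lemma cs_memD x y : Y x -> Y y -> Y (x + y).
Proof. by move=> Yx Yy; rewrite -(scale1r x); exact: (cs_lin hY). Qed.

Lemma cs_memZ a x : Y x -> Y (a *: x).
Proof. by move=> Yx; rewrite -(addr0 (a *: x)); apply: (cs_lin hY) => //; exact: cs_zero hY. Qed.

Lemma cs_memN x : Y x -> Y (- x).
Proof. by move=> Yx; rewrite -scaleN1r; exact: cs_memZ. Qed.

Lemma cs_memB x y : Y x -> Y y -> Y (x - y).
Proof. by move=> Yx Yy; apply: cs_memD => //; exact: cs_memN. Qed.

Lemma cs_opp x : Y x -> q (- x) = q x.
Proof. by move=> Yx; rewrite -scaleN1r (cs_scale hY) // normrN1 mul1r. Qed.

Lemma cs_0 : q 0 = 0.
Proof. by rewrite -(scale0r 0) (cs_scale hY) ?normr0 ?mul0r //; exact: cs_zero hY. Qed.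

Lemma cs_ge0 x : Y x -> 0 <= q x.
Proof.
move=> Yx; have := cs_add hY Yx (cs_memN Yx).
by rewrite subrr cs_0 cs_opp //; lra.
Qed.

Lemma cs_distC x y : Y x -> Y y -> q (x - y) = q (y - x).
Proof. by move=> Yx Yy; rewrite -cs_opp ?opprB //; exact: cs_memB. Qed.

Lemma cs_triangle x y z : Y x -> Y y -> Y z -> q (x - z) <= q (x - y) + q (y - z).
Proof.
move=> Yx Yy Yz; rewrite -(subrKA y); apply: (cs_add hY); exact: cs_memB.
Qed.

(** The balls are nested: the next centre is within [r n / 2] of [y n] and the next radius is at
    most [r n / 2]. The limit of the centres therefore stays in every closed ball. *)
Lemma cs_nested_balls (y : nat -> V) (r : nat -> R) : (forall n, Y (y n)) ->
  (forall n, q (y n.+1 - y n) <= r n / 2) -> (forall n, 0 < r n) ->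
  (forall n, r n.+1 <= r n / 2) ->
  exists2 z, Y z & forall n, q (z - y n) <= r n.
Proof.
move=> Yy yS r0 rS.
have rE n : r n <= r 0%N * 2^-1 ^+ n.
  elim: n => [|n IH]; first by rewrite expr0 mulr1.
  by have := rS n; rewrite exprS; lra.
have [n|z [K [Yz zK]]] := cs_complete hY (c := r 0%N) Yy.
  by have := yS n; have := rE n; have := r0 n; lra.
exists z => // n; rewrite -subr_le0; apply: (@le0_geometric _ _ (K * 2^-1 ^+ n)) => k.
(* The induction closes because [r m / 2 <= r m - r m.+1]. *)
have ynk : q (y (n + k)%N - y n) <= r n - r (n + k)%N.
  elim: k => [|k IH]; first by rewrite addn0 !subrr cs_0.
  rewrite addnS; have := cs_triangle (Yy (n + k).+1) (Yy (n + k)%N) (Yy n).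
  by have := yS (n + k)%N; have := rS (n + k)%N; lra.
have := cs_triangle Yz (Yy (n + k)%N) (Yy n).
have := zK (n + k)%N; have := r0 (n + k)%N; rewrite exprD mulrA; lra.
Qed.

End CompleteSeminorm.

(** * The open mapping theorem for complete seminorms *)

Section OpenMapping.
Variables (R : realType) (U V : lmodType R).
Variables (X : U -> Prop) (p : U -> R) (Y : V -> Prop) (q : V -> R).
Hypotheses (hX : complete_seminorm X p) (hY : complete_seminorm Y q).
Variables (T : {linear U -> V}) (C : R).
Hypotheses (TY : forall x, X x -> Y (T x))
  (Tbound : forall x, X x -> q (T x) <= C * p x)
  (Tsurj : forall y, Y y -> exists2 x, X x & q (y - T x) = 0).

(** This is the Baire category argument: [Y] is covered, up to the kernel of [q], by the images of
    the sets [p <= m]. If none of them were dense in a ball, nested balls avoiding them one after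
    the other would have a common point outside every image. *)
Lemma image_dense_in_ball : exists (m : nat) y0 (r : R), [/\ Y y0, 0 < r &
  forall y, Y y -> q (y - y0) <= r -> forall e : R, 0 < e ->
    exists x, [/\ X x, p x <= m%:R & q (y - T x) <= e]].
Proof.
apply: contrapT => nodense.
(* Failure of density in the ball of radius [r / 2] gives a point [y] at distance more than [e] from
   the image of [p <= m]; the new radius is cut to [r / 2] to keep the balls nested. The pair
   [(0, 0)] is a default for invalid input, which makes [choice] applicable. *)
have step (s : nat * V * R) : exists s' : V * R,
    Y s.1.2 -> 0 < s.2 ->
    [/\ Y s'.1, q (s'.1 - s.1.2) <= s.2 / 2, 0 < s'.2, s'.2 <= s.2 / 2 &
      forall x, X x -> p x <= s.1.1%:R -> s'.2 < q (s'.1 - T x)].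
  case: s => -[m y0] r /=; have [[Yy0 r0]|nYr] := pselect (Y y0 /\ 0 < r); last first.
    by exists (0, 0) => Yy0 r0; case: nYr.
  apply: contrapT => nos; apply: nodense; exists m, y0, (r / 2); split=> //.
    by rewrite divr_gt0.
  move=> y Yy yr e e0; apply: contrapT => nox; apply: nos.
  exists (y, Num.min e (r / 2)) => _ _ /=; split => //.
  - by rewrite lt_min e0 divr_gt0.
  - by rewrite ge_min lexx orbT.
  - move=> x Xx xm; rewrite ltNge; apply/negP => ye; apply: nox; exists x; split => //.
    by apply: le_trans ye _; rewrite ge_min lexx.
have [f fP] := choice step.
pose s := fix s n : V * R := if n is m.+1 then f (m, (s m).1, (s m).2) else (0, 1).
have sY n : Y (s n).1 /\ 0 < (s n).2.
  elim: n => [|n [IH1 IH2]] /=; first by split => //; exact: cs_zero hY.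
  by case: (fP (n, (s n).1, (s n).2) IH1 IH2).
have sS n := fP (n, (s n).1, (s n).2) (sY n).1 (sY n).2.
have [n|n|n|n|z Yz zs] :=
  @cs_nested_balls _ _ _ _ hY (fun n => (s n).1) (fun n => (s n).2).
- exact: (sY n).1.
- by case: (sS n).
- exact: (sY n).2.
- by case: (sS n).
have [x Xx zx] := Tsurj Yz.
(* The ball of index [m.+1] was chosen to miss the image of [p <= m], yet it contains [z], which
   equals [T x] up to the kernel of [q]. *)
pose m := Num.bound (p x).
have xm : p x <= m%:R by apply: ltW; apply: archi_boundP; exact: (cs_ge0 hX Xx).
have [Yf _ _ _ /(_ x Xx xm)] := sS m.
have Ysm := (sY m.+1).1.
have := cs_triangle hY Ysm Yz (TY Xx).
rewrite zx addr0 [leRHS](cs_distC hY) // => /le_trans/(_ (zs m.+1)) /=.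
by move=> /le_lt_trans H /H; rewrite ltxx.
Qed.

(** Density is moved from [y0] to the origin by subtraction: after scaling [y] by [r / t], both
    [(r / t) *: y + y0] and [y0] are approximated within [r / 4], and the difference of the
    preimages is scaled back by [t / r]. *)
Lemma image_dense : exists2 M : R, 0 < M & forall t y, 0 < t -> Y y -> q y <= t ->
  exists x, [/\ X x, p x <= M * t & q (y - T x) <= t / 2].
Proof.
have [m [y0 [r [Yy0 r0 dense]]]] := image_dense_in_ball.
(* The summand 1 keeps the constant positive when [m] is 0. *)
exists (2 * m%:R / r + 1) => [|t y t0 Yy yt].
  by rewrite ltr_wpDl // divr_ge0 ?mulr_ge0 // ltW.
have Yz : Y ((r / t) *: y) by exact: (cs_memZ hY).
have e0 : 0 < r / 4 by rewrite divr_gt0.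
have [|x1 [Xx1 x1m x1e]] := dense ((r / t) *: y + y0) (cs_memD hY Yz Yy0) _ _ e0.
  rewrite addrK (cs_scale hY) // ger0_norm ?divr_ge0 ?(ltW r0) ?(ltW t0) //.
  by rewrite mulrAC ler_pdivrMr // ler_pM2l.
have [|x2 [Xx2 x2m x2e]] := dense y0 Yy0 _ _ e0; first by rewrite subrr (cs_0 hY) ltW.
have tr0 : 0 < t / r by rewrite divr_gt0.
have Xx12 : X (x1 - x2) by exact: (cs_memB hX).
exists ((t / r) *: (x1 - x2)); split; first exact: (cs_memZ hX).
  rewrite (cs_scale hX) // gtr0_norm //.
  have : p (x1 - x2) <= 2 * m%:R.
    have := cs_add hX Xx1 (cs_memN hX Xx2); rewrite (cs_opp hX) //; lra.
  rewrite -(ler_pM2l tr0) => /le_trans; apply.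
  lra.
have -> : y - T ((t / r) *: (x1 - x2)) =
    (t / r) *: (((r / t) *: y + y0 - T x1) - (y0 - T x2)).
  rewrite linearZ linearB.
  have -> : (r / t) *: y + y0 - T x1 - (y0 - T x2) = (r / t) *: y - (T x1 - T x2).
    rewrite !opprB [T x2 - y0]addrC [T x2 - T x1]addrC !addrA.
    by rewrite [_ - T x1 - y0]addrAC addrK.
  rewrite [RHS]scalerBr scalerA.
  have -> : t / r * (r / t) = 1.
    by rewrite mulrA divfK ?gt_eqF // divff // gt_eqF.
  by rewrite scale1r.
have Y1 : Y ((r / t) *: y + y0 - T x1) by exact: (cs_memB hY (cs_memD hY Yz Yy0) (TY Xx1)).
have Y2 : Y (y0 - T x2) by exact: (cs_memB hY Yy0 (TY Xx2)).
rewrite (cs_scale hY) ?gtr0_norm //; last exact: (cs_memB hY).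
have := cs_add hY Y1 (cs_memN hY Y2); rewrite (cs_opp hY) // => Y12.
have H : q ((r / t) *: y + y0 - T x1 - (y0 - T x2)) <= r / 2 by lra.
by rewrite -ler_pdivlMl // (le_trans H) // invf_div mulrA divfK // gt_eqF.
Qed.

(** Successive approximation turns density into solvability: each correction halves the bound on the
    residual, and the corrections form a geometric series, whose sum doubles the constant [M]. *)
Theorem open_mapping : exists2 M : R, 0 < M & forall y, Y y ->
  exists x, [/\ X x, p x <= M * q y & q (y - T x) = 0].
Proof.
have [M M0 dense] := image_dense.
exists (2 * M) => [|y Yy]; first by rewrite mulr_gt0.
(* [image_dense] requires a positive bound [t], so the kernel of [q] is treated apart. *)
have [qy0|qy0] := eqVneq (q y) 0.
  exists 0; split; first exact: cs_zero hX.
    by rewrite (cs_0 hX) qy0 mulr0.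
  by rewrite linear0 subr0.
have {qy0} : 0 < q y by rewrite lt_def qy0 (cs_ge0 hY).
set t := q y => t0.
have h0 n : 0 < t * 2^-1 ^+ n by rewrite mulr_gt0 // exprn_gt0 // invr_gt0.
have step (s : nat * V) : exists x, Y s.2 -> q s.2 <= t * 2^-1 ^+ s.1 ->
    [/\ X x, p x <= M * t * 2^-1 ^+ s.1 & q (s.2 - T x) <= t * 2^-1 ^+ s.1.+1].
  have [[Ys st]|nY] := pselect (Y s.2 /\ q s.2 <= t * 2^-1 ^+ s.1); last first.
    by exists 0 => ? ?; case: nY.
  have [x [Xx xM xt]] := dense _ _ (h0 s.1) Ys st.
  by exists x => _ _; split => //; rewrite -?mulrA // exprSr mulrA.
have [f fP] := choice step.
(* [s n] is the partial sum of the corrections; the next one approximates the residual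
   [y - T (s n)]. *)
pose s := fix s n : U := if n is m.+1 then s m + f (m, y - T (s m)) else 0.
have sP n : X (s n) /\ q (y - T (s n)) <= t * 2^-1 ^+ n.
  elim: n => [|n [Xn qn]] /=.
    by rewrite linear0 subr0 expr0 mulr1; split => //; exact: cs_zero hX.
  have [|//|] := fP (n, y - T (s n)); first exact: (cs_memB hY Yy (TY Xn)).
  move=> /= Xf _; rewrite linearD opprD addrA; split => //; exact: (cs_memD hX).
have sS n : p (s n.+1 - s n) <= M * t * 2^-1 ^+ n.
  have [Xn qn] := sP n; have [|//|] := fP (n, y - T (s n)).
    exact: (cs_memB hY Yy (TY Xn)).
  by move=> /= _ pf _; rewrite addrAC subrr add0r.
have sp n : p (s n) <= 2 * M * t * (1 - 2^-1 ^+ n).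
  elim: n => [|n IH]; first by rewrite /= (cs_0 hX) expr0 subrr mulr0.
  have := cs_add hX (cs_memB hX (sP n.+1).1 (sP n).1) (sP n).1.
  by rewrite subrK exprS; have := sS n; lra.
have [n|x [K [Xx xK]]] := cs_complete hX (u := s) _ sS; first exact: (sP n).1.
exists x; split => //.
  rewrite -subr_le0; apply: (@le0_geometric _ _ K) => n.
  have := cs_add hX (cs_memB hX Xx (sP n).1) (sP n).1.
  have : 0 <= M * (t * 2^-1 ^+ n) by rewrite mulr_ge0 // ltW.
  by rewrite subrK; have := sp n; have := xK n; lra.
apply/eqP; rewrite eq_le (cs_ge0 hY) ?andbT; last exact: (cs_memB hY Yy (TY Xx)).
(* The residual at [x] is at most the residual at [s n] plus the image of [s n - x]. The sign of [C]
   is unknown, hence its absolute value. *)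
apply: (@le0_geometric _ _ (t + `|C| * K)) => n.
have [Xn qn] := sP n.
have := cs_triangle hY Yy (TY Xn) (TY Xx).
rewrite -linearB; have Xd := cs_memB hX Xn Xx; have := Tbound Xd.
have : C * p (s n - x) <= `|C| * (K * 2^-1 ^+ n).
  apply: le_trans (ler_wpM2l (normr_ge0 C) (xK n)).
  rewrite (cs_distC hX) //; apply: ler_wpM2r; last exact: ler_norm.
  exact: (cs_ge0 hX (cs_memB hX Xx Xn)).
lra.
Qed.

End OpenMapping.

(** * Products of complete seminorms and the [l^1] norm *)

Lemma complete_seminorm_prod (R : realType) (U V : lmodType R)
    (X : U -> Prop) (p : U -> R) (Y : V -> Prop) (q : V -> R) :
  complete_seminorm X p -> complete_seminorm Y q ->
  complete_seminorm (fun z : U * V => X z.1 /\ Y z.2) (fun z => p z.1 + q z.2).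
Proof.
move=> hX hY; split.
- by split; [exact: cs_zero hX | exact: cs_zero hY].
- by move=> a x y [? ?] [? ?]; split; [exact: (cs_lin hX) | exact: (cs_lin hY)].
- move=> x y [x1 x2] [y1 y2] /=.
  by have := cs_add hX x1 y1; have := cs_add hY x2 y2; lra.
- by move=> a x [x1 x2] /=; rewrite (cs_scale hX) // (cs_scale hY) // mulrDr.
- move=> u c Zu uc.
  have [n|n|x [K [Xx xK]]] := cs_complete hX (u := fun n => (u n).1) (c := c).
  + exact: (Zu n).1.
  + apply: le_trans (uc n); rewrite lerDl.
    exact: (cs_ge0 hY (cs_memB hY (Zu n.+1).2 (Zu n).2)).
  have [n|n|y [K' [Yy yK]]] := cs_complete hY (u := fun n => (u n).2) (c := c).
  + exact: (Zu n).2.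
  + apply: le_trans (uc n); rewrite lerDr.
    exact: (cs_ge0 hX (cs_memB hX (Zu n.+1).1 (Zu n).1)).
  exists (x, y), (K + K'); split => // n; rewrite mulrDl /=.
  exact: lerD (xK n) (yK n).
Qed.

Lemma complete_seminorm_l1 (R : realType) (I : finType) :
  complete_seminorm (fun _ : I -> R^o => True) (fun a => \sum_j `|a j|).
Proof.
split=> //.
- by move=> a b _ _; rewrite -big_split /=; apply: ler_sum => j _; exact: ler_normD.
- by move=> c a _; rewrite mulr_sumr; apply: eq_bigr => j _; exact: normrM.
- move=> u c _ uc.
  have ucj j n : `|u n.+1 j - u n j| <= c * 2^-1 ^+ n.
    by apply: le_trans (uc n); rewrite (bigD1 j) //= lerDl sumr_ge0.
  have [a aP] := choice (fun j => geometric_cauchy_cvg (ucj j)).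
  exists a, (\sum_(j : I) (2 * c)); split => // n; rewrite mulr_suml.
  by apply: ler_sum => j _; exact: aP.
Qed.

(** * Quasimorphisms and completeness of the defect *)

Section Quasimorphisms.
Variables (G : groupType) (R : realType).
Implicit Types (H : G -> Prop) (f g : G -> R^o).

Lemma le_defect H f x y : quasimorphism H f -> H x -> H y ->
  `|f (x * y)%g - f x - f y| <= defect H f.
Proof.
move=> [C fC] Hx Hy; apply: ub_le_sup; last by exists x, y.
by exists C => _ [x' [y' [? ? ->]]]; exact: fC.
Qed.

Lemma defect_le H f C : H 1%g ->
  (forall x y, H x -> H y -> `|f (x * y)%g - f x - f y| <= C) -> defect H f <= C.
Proof.
move=> H1 fC; apply: ge_sup; last by move=> _ [x [y [? ? ->]]]; exact: fC.
by exists `|f (1 * 1)%g - f 1%g - f 1%g|, 1%g, 1%g.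
Qed.

Lemma defect0P H f : H 1%g -> quasimorphism H f ->
  defect H f = 0 <-> (forall x y, H x -> H y -> f (x * y)%g = f x + f y).
Proof.
move=> H1 fq; split => [f0 x y Hx Hy|fD].
  apply/eqP; rewrite -subr_eq0 opprD addrA -normr_le0 -f0; exact: le_defect.
apply/eqP; rewrite eq_le; apply/andP; split.
  by apply: defect_le => // x y Hx Hy; rewrite fD // -addrA -opprD subrr normr0.
exact: le_trans (normr_ge0 _) (le_defect fq H1 H1).
Qed.

Lemma defectD H f g : H 1%g -> quasimorphism H f -> quasimorphism H g ->
  defect H (f + g) <= defect H f + defect H g.
Proof.
move=> H1 fq gq; apply: defect_le => // x y Hx Hy; rewrite !addrfctE.
have -> : f (x * y)%g + g (x * y)%g - (f x + g x) - (f y + g y) =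
  (f (x * y)%g - f x - f y) + (g (x * y)%g - g x - g y) by ring.
by apply: le_trans (ler_normD _ _) _; apply: lerD; exact: le_defect.
Qed.

Lemma quasimorphismZ H a f : quasimorphism H f -> quasimorphism H (a *: f).
Proof.
move=> [C fC]; exists (`|a| * C) => x y Hx Hy; rewrite scalrfctE -!mulrBr normrM.
by apply: ler_wpM2l => //; exact: fC.
Qed.

Lemma defectZ H a f : H 1%g -> quasimorphism H f ->
  defect H (a *: f) = `|a| * defect H f.
Proof.
move=> H1 fq.
have leZ b (h : G -> R^o) : quasimorphism H h -> defect H (b *: h) <= `|b| * defect H h.
  move=> hq; apply: defect_le => // x y Hx Hy; rewrite scalrfctE -!mulrBr normrM.
  by apply: ler_wpM2l => //; exact: le_defect.
apply/eqP; rewrite eq_le leZ //=.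
have [->|a0] := eqVneq a 0.
  rewrite scale0r normr0 mul0r.
  have q0 : quasimorphism H (0 : G -> R^o) by rewrite -(scale0r f); exact: quasimorphismZ.
  exact: le_trans (normr_ge0 _) (le_defect q0 H1 H1).
(* The reverse inequality is the one just proved, for the scalar [a^-1] and the function
   [a *: f]. *)
have := leZ a^-1 _ (quasimorphismZ a fq).
rewrite scalerA mulVf // scale1r normfV.
by rewrite -ler_pdivrMl ?invr_gt0 ?normr_gt0 // invrK.
Qed.

Lemma QG_lin H a f g : QG H f -> QG H g -> QG H (a *: f + g).
Proof.
move=> [fh [C fC] fi] [gh [D gD] gi]; split.
- move=> h Hh n; rewrite addrfctE scalrfctE /=.
  have [-> ->] := fh h Hh n; have [-> ->] := gh h Hh n.
  by split; rewrite /GRing.scale /=; ring.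
- exists (`|a| * C + D) => x y Hx Hy; rewrite addrfctE scalrfctE.
  have -> : a *: f (x * y)%g + g (x * y)%g - (a *: f x + g x) - (a *: f y + g y) =
    a * (f (x * y)%g - f x - f y) + (g (x * y)%g - g x - g y).
    by rewrite /GRing.scale /=; ring.
  apply: le_trans (ler_normD _ _) _; rewrite normrM.
  by apply: lerD; [apply: ler_wpM2l => //; exact: fC | exact: gD].
- by move=> x h Hh; rewrite addrfctE scalrfctE fi // gi.
Qed.

Lemma QG0 H : QG H (0 : G -> R^o).
Proof.
by split; [move=> h _ n; rewrite mulr0 oppr0 | exists 0 => x y _ _; rewrite !subr0 normr0 |].
Qed.

(* Defect-Cauchy sequences need not converge pointwise, so the limit is taken
   with a linear functional on all real sequences that extends the limit. *)
Lemma QG_complete H (u : nat -> G -> R^o) c : H 1%g -> (forall n, QG H (u n)) ->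
  (forall n, defect H (u n.+1 - u n) <= c * 2^-1 ^+ n) ->
  exists f K, QG H f /\ forall n, defect H (f - u n) <= K * 2^-1 ^+ n.
Proof.
move=> H1 Qu uc; have [Lim [LimP Limlim]] := generalized_limit R.
have Lim0 : Lim (fun=> 0) = 0.
  by apply: (Limlim _ _ 0) => n; rewrite subrr normr0 mul0r.
have LimZ a (v : nat -> R) : Lim (fun n => a * v n) = a * Lim v.
  rewrite -[RHS]addr0 -Lim0 -LimP; congr Lim; apply/funext => n; by rewrite addr0.
have LimB (v w : nat -> R) : Lim (fun n => v n - w n) = Lim v - Lim w.
  rewrite [RHS]addrC -mulN1r -LimP; congr Lim; apply/funext => n.
  by rewrite mulN1r addrC.
pose f x : R^o := Lim (fun n => u n x).
(* For fixed [x] and [y] the defect terms converge geometrically, as the defects of [u k.+1 - u k]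
   control their increments; so [Lim] gives their true limit, with a rate uniform in [x] and [y]. *)
have df x y n : H x -> H y ->
    `|(f (x * y)%g - f x - f y) - (u n (x * y)%g - u n x - u n y)| <= 2 * c * 2^-1 ^+ n.
  move=> Hx Hy; pose d k := u k (x * y)%g - u k x - u k y.
  have dc k : `|d k.+1 - d k| <= c * 2^-1 ^+ k.
    apply: le_trans (uc k).
    have -> : d k.+1 - d k = (u k.+1 - u k) (x * y)%g - (u k.+1 - u k) x - (u k.+1 - u k) y.
      by rewrite /d !(addrfctE, opprfctE) /=; ring.
    apply: le_defect => //.
    have := QG_lin (-1) (Qu k) (Qu k.+1).
    by rewrite scaleN1r addrC => -[].
  have [r rP] := geometric_cauchy_cvg dc.
  by rewrite -[f _ - _ - _]/(_ - _ - _) -!LimB (Limlim _ _ _ rP); exact: rP.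
exists f, (2 * c); split; last first.
  move=> n; apply: defect_le => // x y Hx Hy.
  apply: le_trans (df x y n Hx Hy); rewrite !(addrfctE, opprfctE) /=.
  by rewrite le_eqVlt; apply/orP; left; apply/eqP; congr `|_|; ring.
(* Homogeneity for a fixed exponent and invariance are linear identities between values, so [Lim]
   preserves them; the defect of [f] is bounded by comparison with [u 0]. *)
split.
- move=> h Hh n; rewrite /f -!mulNr -!LimZ.
  by split; congr Lim; apply/funext => k; have [/(_ h Hh n)[E1 E2] _ _] := Qu k;
    rewrite ?E1 ?E2 ?mulNr.
- have [_ [C uC] _] := Qu 0%N; exists (2 * c + C) => x y Hx Hy.
  have := df x y 0%N Hx Hy; have := uC x y Hx Hy.
  rewrite expr0 mulr1 !ler_norml; lra.
- move=> g h Hh; rewrite /f; congr Lim; apply/funext => k.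
  by have [_ _ ->] := Qu k.
Qed.

Lemma complete_seminorm_QG H : H 1%g ->
  complete_seminorm (fun f : G -> R^o => QG H f) (fun f => defect H f).
Proof.
move=> H1; split.
- exact: QG0.
- by move=> a f g; exact: QG_lin.
- by move=> f g [_ fq _] [_ gq _]; exact: defectD.
- by move=> a f [_ fq _]; exact: defectZ.
- by move=> u c; exact: QG_complete.
Qed.

Lemma QG_sub (L N : G -> Prop) f : (forall x, N x -> L x) -> QG L f -> QG N f.
Proof.
move=> NL [fh [C fC] fi]; split.
- by move=> h /NL; exact: fh.
- by exists C => x y /NL Lx /NL; exact: fC.
- by move=> g h /NL; exact: fi.
Qed.

Lemma defect_sub (L N : G -> Prop) f : (forall x, N x -> L x) -> N 1%g ->
  quasimorphism L f -> defect N f <= defect L f.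
Proof. by move=> NL N1 fq; apply: defect_le => // x y /NL ? /NL; exact: le_defect. Qed.

(** * The map from pairs of a quasimorphism and a coefficient tuple *)

Variables (l : nat) (nus : 'I_l -> G -> R^o).

(** The restriction [i^*] leaves no trace here, since functions on [L] and on [N] are both
    represented on all of [G]. *)
Definition recombine (z : (G -> R^o) * ('I_l -> R^o)) : G -> R^o :=
  z.1 + \sum_j z.2 j *: nus j.

Lemma recombine_is_linear : linear recombine.
Proof.
move=> a x y; rewrite /recombine scalerDr addrACA; congr (_ + _).
rewrite scaler_sumr -big_split; apply: eq_bigr => j _ /=.
by rewrite scalerA -scalerDl.
Qed.

HB.instance Definition _ := GRing.isLinear.Build R _ _ _ recombine recombine_is_linear.

Lemma recombineE z x : recombine z x = z.1 x + \sum_j z.2 j * nus j x.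
Proof. by rewrite /recombine addrfctE fct_sumE. Qed.

Lemma recombine_QG (L N : G -> Prop) z : (forall x, N x -> L x) ->
  (forall j, QG N (nus j)) -> QG L z.1 -> QG N (recombine z).
Proof.
move=> NL Qnus Qz.
have QD f g : QG N f -> QG N g -> QG N (f + g).
  by move=> Qf Qg; have := QG_lin 1 Qf Qg; rewrite scale1r.
apply: (QD); first exact: QG_sub Qz.
apply: (big_ind (fun f : G -> R^o => QG N f)).
- exact: QG0.
- exact: QD.
- by move=> j _; have := QG_lin (z.2 j) (Qnus j) (QG0 N); rewrite addr0.
Qed.

Lemma defect_recombine (L N : G -> Prop) : N 1%g -> (forall x, N x -> L x) ->
  (forall j, QG N (nus j)) -> exists C : R, forall z, QG L z.1 ->
  defect N (recombine z) <= C * (defect L z.1 + \sum_j `|z.2 j|).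
Proof.
move=> N1 NL Qnus; have hN := complete_seminorm_QG N1.
have L1 := NL _ N1; have hL := complete_seminorm_QG L1.
have d0 j : 0 <= defect N (nus j) by exact: (cs_ge0 hN (Qnus j)).
(* The summand 1 serves [z.1], whose defect can only drop on restriction to [N]; the sum dominates
   each defect of a [nus j]. *)
pose C := 1 + \sum_j defect N (nus j).
have C1 : 1 <= C by rewrite lerDl sumr_ge0.
exists C => z Qz.
have sum_le (s : seq 'I_l) : QG N (\sum_(j <- s) z.2 j *: nus j) /\
    defect N (\sum_(j <- s) z.2 j *: nus j) <= C * \sum_(j <- s) `|z.2 j|.
  elim: s => [|j s [Qs IH]].
    by rewrite !big_nil (cs_0 hN) mulr0; split => //; exact: QG0.
  have Qj := cs_memZ hN (z.2 j) (Qnus j).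
  rewrite !big_cons; split; first exact: (cs_memD hN).
  apply: le_trans (cs_add hN Qj Qs) _; rewrite mulrDr; apply: lerD => //.
  rewrite (cs_scale hN) // mulrC ler_wpM2r // /C (bigD1 j) //= addrCA lerDl.
  by rewrite addr_ge0 // sumr_ge0.
have [Qs sle] := sum_le (index_enum 'I_l).
apply: le_trans (cs_add hN (QG_sub NL Qz) Qs) _; rewrite mulrDr; apply: lerD => //.
have [_ zq _] := Qz.
apply: le_trans (defect_sub NL N1 zq) _; apply: ler_peMl => //.
exact: (cs_ge0 hL Qz).
Qed.

End Quasimorphisms.

(** * The defect inequality *)

Theorem theorem5p2 (G : groupType) (R : realType) (L N : G -> Prop)
    (hL : is_normal L) (hN : is_normal N) (hNL : forall x, N x -> L x)
    (l : nat) (nus : 'I_l -> G -> R) (hbasis : W_basis L N nus) :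
  exists C1 C2 : R, [/\ 0 < C1, 0 < C2 &
    forall nu : G -> R, QG N nu ->
      exists (k psi : G -> R) (a : 'I_l -> R),
        [/\ H1G N k, QG L psi,
            (forall x, N x -> nu x = k x + psi x + \sum_(j < l) a j * nus j x) &
            defect N nu >= C1^-1 * (defect L psi + C2^-1 * \sum_(j < l) `|a j|)]].
Proof.
have [Qnus span _] := hbasis.
have N1 : N 1%g by have [[]] := hN.
have cN := complete_seminorm_QG R N1.
have cL := complete_seminorm_QG R (hNL _ N1).
have cX := complete_seminorm_prod cL (complete_seminorm_l1 R 'I_l).
have [C TC] := defect_recombine N1 hNL Qnus.
have [z [Qz _]|z [Qz _]|nu Qnu|M M0 open] :=
  @open_mapping R _ _ _ _ _ _ cX cN (recombine nus) C.
- exact: (recombine_QG hNL Qnus Qz).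
- exact: TC.
(* Spanning gives surjectivity up to the kernel: on [N] the difference is the homomorphism [k], so
   its defect vanishes. *)
- have [a [k [psi [[kD _] Qpsi nuE]]]] := span nu Qnu.
  exists (psi, a) => //.
  have Qd := cs_memB cN Qnu (recombine_QG (z := (psi, a)) hNL Qnus Qpsi).
  have [_ dq _] := Qd; apply/(defect0P N1 dq) => x y Nx Ny.
  have dE w : N w -> (nu - recombine nus (psi, a)) w = k w.
    move=> Nw; rewrite addrfctE opprfctE recombineE nuE //=; ring.
  have Nxy : N (x * y)%g by have [[_ + _] _] := hN; exact.
  by rewrite !dE // kD.
(* The constant [C2] is 1 because the product seminorm already adds the defect and the [l^1] norm
   with equal weights. *)
exists M, 1; split => // nu Qnu.
have [[psi a] [[/= Qpsi _] pM d0]] := open nu Qnu.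
have Qd := cs_memB cN Qnu (recombine_QG (z := (psi, a)) hNL Qnus Qpsi).
have [_ dq di] := Qd.
(* The remainder has defect 0 on [N], so it is an invariant homomorphism there. The decomposition
   makes [a] the coordinate tuple of the class of [nu], which is unique by the independence clause
   of [W_basis]. *)
exists (nu - recombine nus (psi, a)), psi, a; split => //.
- by split => //; apply/(defect0P N1 dq).
- by move=> x _; rewrite addrfctE opprfctE recombineE /=; ring.
- by rewrite invr1 mul1r ler_pdivrMl.
Qed.
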